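(* Let $\rho_0\in \mathrm{L}^\infty(\mathbb{R};\mathbb{R}_+)$. If the CFL condition $$\frac{\Delta t}{\Delta x}\le \min\left\{\frac{8-27\alpha}{27\|\partial_\rho f\|},\ \frac{2}{27\|\partial_\rho f\|},\ \frac{\alpha}{\|\partial_\rho f\|}\right\}$$ holds, then the approximate solution $\rho_\Delta$ obtained from the MUSCL-Hancock scheme described in the context satisfies $\rho_\Delta(t,x)\ge 0$ for a.e. $(t,x)\in\mathbb{R}_+\times\mathbb{R}$.
   Context: Notation: $\mathbb{R}_+=[0,\infty)$; $\|\cdot\|$ denotes the $\mathrm{L}^\infty$ norm (for $\partial_\rho f$ over $\mathbb{R}\times\mathbb{R}$). Problem: $\partial_t\rho+\partial_x f(\rho,A(t,x))=0$ on $(0,\infty)\times\mathbb{R}$, $\rho(0,x)=\rho_0(x)$, where $A(t,x)=\int_{\mathbb{R}}\mu(x-y)\rho(t,y)\,dy$. Standing hypotheses on $f=f(\rho,A):\mathbb{R}\times\mathbb{R}\to\mathbb{R}$ and $\mu:\mathbb{R}\to\mathbb{R}$: $f\in \mathrm{C}^2(\mathbb{R}\times\mathbb{R};\mathbb{R})$, $\partial_\rho f\in \mathrm{L}^\infty(\mathbb{R}\times\mathbb{R})$, $f(0,A)=0$ for all $A\in\mathbb{R}$; there is $M>0$ with $|\partial_A f(\rho,A)|,\ |\partial^2_{AA}f(\rho,A)|\le M|\rho|$ for all $\rho,A$; $\partial_\rho f\in \mathrm{W}^{1,\infty}(\mathbb{R}\times\mathbb{R})$; $\mu\in \mathrm{C}_c^2\cap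 \mathrm{W}^{2,\infty}(\mathbb{R};\mathbb{R})$. Scheme. Fix $\theta\in[0,\tfrac12]$, $\alpha\in(0,\tfrac{8}{27})$, $\Delta x,\Delta t>0$, $\lambda=\Delta t/\Delta x$, $x_j=j\Delta x$, $x_{j+1/2}=x_j+\Delta x/2$, $t^n=n\Delta t$, $\mu_j=\mu(j\Delta x)$ ($j\in\mathbb{Z}$, $n\in\mathbb{N}\cup\{0\}$). Set $\rho^0_j=\frac1{\Delta x}\int_{x_{j-1/2}}^{x_{j+1/2}}\rho_0(x)\,dx$. Given $(\rho^n_j)_{j\in\mathbb{Z}}$: (1) Slopes: $\sigma^n_j=2\theta\,\mathrm{minmod}\big(\rho^n_j-\rho^n_{j-1},\ \tfrac12(\rho^n_{j+1}-\rho^n_{j-1}),\ \rho^n_{j+1}-\rho^n_j\big)$, where minmod of several numbers is $0$ unless all are nonzero with the same sign, in which case it is the one of smallest absolute value. Face values: $\rho^{n,-}_{j+1/2}=\rho^n_j+\tfrac12\sigma^n_j$, $\rho^{n,+}_{j-1/2}=\rho^n_j-\tfrac12\sigma^n_j$. (2) Convolutions: $A^n_j=\Delta x\sum_{l\in\mathbb{Z}}\mu_{j-l}\rho^n_l$, $s^n_j=\theta(A^n_{j+1}-A^n_{j-1})$, $A^{n,-}_{j+1/2}=A^n_j+\tfrac12 s^n_j$, $A^{n,+}_{j-1/2}=A^n_j-\tfrac12 s^n_j$. (3) Mid-time values: $\rho^{n+1/2,-}_{j+1/2}=\rho^{n,-}_{j+1/2}-\tfrac{\lambda}{2}\delta^n_j$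 and $\rho^{n+1/2,+}_{j-1/2}=\rho^{n,+}_{j-1/2}-\tfrac{\lambda}{2}\delta^n_j$, with $\delta^n_j=f(\rho^{n,-}_{j+1/2},A^{n,-}_{j+1/2})-f(\rho^{n,+}_{j-1/2},A^{n,+}_{j-1/2})$. (4) Mid-time convolution: $A^{n+1/2}_{j+1/2}=\tfrac{\Delta x}{2}\sum_{l\in\mathbb{Z}}\big[\mu_{j+1-l}\,\rho^{n+1/2,+}_{l-1/2}+\mu_{j-l}\,\rho^{n+1/2,-}_{l+1/2}\big]$. (5) Update: $\rho^{n+1}_j=\rho^n_j-\lambda\big[F^{n+1/2}_{j+1/2}-F^{n+1/2}_{j-1/2}\big]$, where $F^{n+1/2}_{j+1/2}=F(\rho^{n+1/2,-}_{j+1/2},\rho^{n+1/2,+}_{j+1/2},A^{n+1/2}_{j+1/2})$ and $F(u,v,A)=\tfrac12\big(f(u,A)+f(v,A)\big)-\tfrac{\alpha}{2\lambda}(v-u)$. Approximate solution: $\rho_\Delta(t,x)=\rho^n_j$ for $(t,x)\in[t^n,t^{n+1})\times[x_{j-1/2},x_{j+1/2})$, $n\in\mathbb{N}\cup\{0\}$, $j\in\mathbb{Z}$. In the CFL condition, quotients by $\|\partial_\rho f\|$ are read as $+\infty$ if $\|\partial_\rho f\|=0$. *)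

(* Defs.v *)
From mathcomp Require Export all_boot all_order all_algebra.
From mathcomp Require Export all_classical all_reals all_analysis.
From mathcomp Require Import lra.
Export Order.TTheory GRing.Theory Num.Theory.
Export numFieldNormedType.Exports.

Set Implicit Arguments.
Unset Strict Implicit.
Unset Printing Implicit Defensive.

Local Open Scope classical_set_scope.
Local Open Scope ring_scope.

(* The functions of class C^k, in terms of the iterated partial derivatives
   along the vectors of a basis e. *)
Fixpoint Ck {R : realType} {V : normedModType R} {I : Type} (e : I -> V)
    (k : nat) (g : V -> R) : Prop :=
  continuous g /\
  if k is k'.+1 then
    forall i, (forall x, derivable g x (e i)) /\ Ck e k' ('D_(e i) g)
  else True.

Definition compactly_supported {R : realType} {V : normedModType R}
    (g : V -> R) : Prop :=
  compact (closure [set x | g x != 0]).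

Definition Cc_infty {R : realType} {V : normedModType R} {I : Type}
    (e : I -> V) : set (V -> R) :=
  [set phi | (forall k, Ck e k phi) /\ compactly_supported phi].

(* h is the weak derivative of g associated with the classical derivation D,
   for the class of test functions [test]. *)
Definition weak_derivative {d : measure_display} {T : measurableType d}
    {R : realType} (m : {measure set T -> \bar R}) (test : set (T -> R))
    (D : (T -> R) -> T -> R) (g h : T -> R) : Prop :=
  forall phi, test phi ->
    \int[m]_x (g x * D phi x) = - \int[m]_x (h x * phi x).

(* The Sobolev space W^{k,oo}; D i is the derivation in the i-th direction. *)
Fixpoint Wkinfty {d : measure_display} {T : measurableType d} {R : realType}
    (m : {measure set T -> \bar R}) (test : set (T -> R)) {I : Type}
    (D : I -> (T -> R) -> T -> R) (k : nat) (g : T -> R) : Prop :=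
  g \in Lfun m +oo%E /\
  if k is k'.+1 then
    forall i, exists2 h, weak_derivative m test (D i) g h
                       & Wkinfty m test D k' h
  else True.

Section euclidean.
Context {R : realType}.

Definition leb2 : {measure set (measurableTypeR R * measurableTypeR R) -> \bar R} :=
  ((@lebesgue_measure R) \x (@lebesgue_measure R))%E.

Definition basis1 (_ : unit) : R := 1.

Definition basis2 (b : bool) : R * R := if b then (1, 0) else (0, 1).

Definition Ck1 (k : nat) (g : R -> R) : Prop := Ck basis1 k g.

Definition Ck2 (k : nat) (g : R * R -> R) : Prop := Ck basis2 k g.

Definition Wkinfty1 (k : nat) (g : R -> R) : Prop :=
  Wkinfty (@lebesgue_measure R) (Cc_infty basis1)
    (fun i phi => 'D_(basis1 i) phi) k g.

Definition Wkinfty2 (k : nat) (g : R * R -> R) : Prop :=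
  Wkinfty leb2 (Cc_infty basis2) (fun i phi => 'D_(basis2 i) phi) k g.

(* f is a function of the pair (rho, A). *)
Definition d_rho (f : R * R -> R) : R * R -> R := 'D_((1, 0) : R * R) f.

Definition d_A (f : R * R -> R) : R * R -> R := 'D_((0, 1) : R * R) f.

Definition minmod (a b c : R) : R :=
  if [&& 0 < a, 0 < b & 0 < c] then Num.min a (Num.min b c)
  else if [&& a < 0, b < 0 & c < 0] then Num.max a (Num.max b c)
  else 0.

End euclidean.

(* Half-integer indices: a quantity at the interface x_{j+1/2} taken from the
   left (superscript -) is indexed by j, and a quantity at x_{j-1/2} taken from
   the right (superscript +) is also indexed by j. Thus both are attached to
   the j-th cell, and the "+" value at x_{j+1/2} has index j + 1. Quantities
   with a single value at x_{j+1/2} are indexed by j.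
   The sums over the integers are finitely supported as mu has compact
   support. *)
Section muscl_hancock.
Context {R : realType}.
Variables (f : R * R -> R) (mu : R -> R) (theta alpha dx dt : R).
Implicit Types (rho : int -> R) (j : int).

Definition lambda : R := dt / dx.

Definition slope rho j : R :=
  2 * theta * minmod (rho j - rho (j - 1))
                     ((rho (j + 1) - rho (j - 1)) / 2)
                     (rho (j + 1) - rho j).

Definition face_minus rho j : R := rho j + slope rho j / 2.

Definition face_plus rho j : R := rho j - slope rho j / 2.

Definition mu_ j : R := mu (j%:~R * dx).

Definition conv rho j : R :=
  dx * \sum_(l \in [set: int]) (mu_ (j - l) * rho l).

Definition conv_slope rho j : R :=
  theta * (conv rho (j + 1) - conv rho (j - 1)).

Definition conv_minus rho j : R := conv rho j + conv_slope rho j / 2.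

Definition conv_plus rho j : R := conv rho j - conv_slope rho j / 2.

Definition delta rho j : R :=
  f (face_minus rho j, conv_minus rho j) - f (face_plus rho j, conv_plus rho j).

Definition mid_minus rho j : R := face_minus rho j - lambda / 2 * delta rho j.

Definition mid_plus rho j : R := face_plus rho j - lambda / 2 * delta rho j.

Definition mid_conv rho j : R :=
  dx / 2 * \sum_(l \in [set: int])
    (mu_ (j + 1 - l) * mid_plus rho l + mu_ (j - l) * mid_minus rho l).

Definition num_flux (u v A : R) : R :=
  (f (u, A) + f (v, A)) / 2 - alpha / (2 * lambda) * (v - u).

Definition mid_flux rho j : R :=
  num_flux (mid_minus rho j) (mid_plus rho (j + 1)) (mid_conv rho j).

Definition update rho : int -> R :=
  fun j => rho j - lambda * (mid_flux rho j - mid_flux rho (j - 1)).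

Definition cell_average (rho0 : R -> R) j : R :=
  dx^-1 * \int[lebesgue_measure]_(x in
             `[(j%:~R - 2^-1) * dx, (j%:~R + 2^-1) * dx]) rho0 x.

Definition scheme (rho0 : R -> R) (n : nat) : int -> R :=
  iter n update (cell_average rho0).

(* For t < 0, Num.truncn (t / dt) is 0. *)
Definition approx_solution (rho0 : R -> R) (t x : R) : R :=
  scheme rho0 (Num.truncn (t / dt)) (Num.floor (x / dx + 2^-1)).

Lemma approx_solutionE (rho0 : R -> R) (n : nat) j (t x : R) : 0 < dx -> 0 < dt ->
  n%:R * dt <= t < n.+1%:R * dt ->
  (j%:~R - 2^-1) * dx <= x < (j%:~R + 2^-1) * dx ->
  approx_solution rho0 t x = scheme rho0 n j.
Proof.
move=> dx0 dt0 /andP[t1 t2] /andP[x1 x2]; rewrite /approx_solution.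
congr scheme.
  by apply: truncn_def; rewrite ler_pdivlMr// t1 ltr_pdivrMr.
apply: floor_def; rewrite -lerBlDr ler_pdivlMr// x1/= -ltrBrDr ltr_pdivrMr//.
by rewrite intrD (_ : j%:~R + 1 - 2^-1 = j%:~R + 2^-1 :> R)//; lra.
Qed.

End muscl_hancock.

(* Main.v *)
Require Import Defs.
From mathcomp Require Import measurable_realfun ess_sup_inf lra ring.

(** The proof is an induction on the time step: if all the cell values rho_j
are nonnegative, so are the updated ones.  Everything rests on a single
property of the flux, [le_d_rho_bound]: since f vanishes at rho = 0,
|f (r, A)| <= l |r| with l the sup norm of d_rho f, uniformly in A.  The values
of the convolutions are therefore irrelevant to positivity.

Write a for the ratio dt / dx.  Limiting by minmod with theta <= 1/2 gives
|slope_j| <= rho_j ([slope_le]), so that the face values of the cell j lie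
between rho_j / 2 and 3 rho_j / 2 and add up to 2 rho_j; hence
|delta_j| <= 2 l rho_j, and a l <= 2/27 makes the mid-time values m_j (minus)
and p_j (plus) nonnegative ([mid_ge0]).  In the update, each neighbouring
mid-time value v in { m_(j-1), p_(j+1) } contributes alpha v / 2 by the
numerical viscosity and at worst - a l v / 2 by the flux, a nonnegative amount
as a l <= alpha.  What remains is at least
  rho_j - (alpha + a l) / 2 * (m_j + p_j),
where alpha + a l <= 8/27 and m_j + p_j = 2 rho_j - a delta_j is at most
(2 + 4/27) rho_j, so it is nonnegative as well ([update_ge0]).

The CFL condition bounds a l by means of an essential supremum for the planar
Lebesgue measure, whereas the mean value theorem needs a bound at every point.
The two agree because d_rho f is continuous and nonempty open sets are not
negligible ([continuous_le_Lnormy]). *)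

Set Implicit Arguments.
Unset Strict Implicit.
Unset Printing Implicit Defensive.

Local Open Scope classical_set_scope.
Local Open Scope ring_scope.

(** A neighbourhood contains an open box, whose measure is the product of the
lengths of its sides; stated for a measurable superset so that the
neighbourhood itself need not be measurable. *)
Lemma leb2_nbhs_gt0 (R : realType) (z : R * R) (U N : set (R * R)) :
  nbhs z U -> measurable (N : set (measurableTypeR R * measurableTypeR R)) ->
  U `<=` N -> (0 < @leb2 R N)%E.
Proof.
move=> /nbhs_ballP[e /= e0 zU] mN UN.
have mb (x : R) : measurable (ball x e : set (measurableTypeR R)).
  by exact: measurable_ball.
have le_box : (@leb2 R (ball z.1 e `*` ball z.2 e) <= @leb2 R N)%E.
  apply: le_measure; rewrite ?inE//; first exact: measurableX.
  by move=> w [w1 w2]; apply/UN/zU; split.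
apply: lt_le_trans le_box.
have -> : @leb2 R (ball z.1 e `*` ball z.2 e) =
    (lebesgue_measure (ball z.1 e) * lebesgue_measure (ball z.2 e))%E.
  exact: product_measure1E (mb z.1) (mb z.2).
rewrite !lebesgue_measure_ball ?(ltW e0)//.
by rewrite -EFinM lte_fin mulr_gt0// pmulrn_lgt0.
Qed.

(** At a point where the bound fails, it would fail on a neighbourhood, which
is not negligible. *)
Lemma ae_le_continuous (R : realType) (g : R * R -> R) (c : R) :
  continuous g -> {ae @leb2 R, forall z, g z <= c} -> forall z, g z <= c.
Proof.
move=> gc [N [mN N0 gN]] z; rewrite leNgt; apply/negP => cgz.
have : nbhs z [set w | c < g w].
  by apply: (gc z [set y | c < y]); exact: lt_nbhsr.
move=> /leb2_nbhs_gt0 /(_ mN) N_gt0.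
suff : (0 < @leb2 R N)%E by rewrite N0 ltxx.
apply: N_gt0 => w /= cgw; apply: gN => /=.
by apply/negP; rewrite -ltNge.
Qed.

Lemma continuous_le_Lnormy (R : realType) (g : R * R -> R) :
  continuous g -> g \in Lfun (@leb2 R) +oo%E ->
  exists2 l : R, 0 <= l /\ 'N[@leb2 R]_(+oo) [EFin \o g]%E = l%:E &
    forall z, `|g z| <= l.
Proof.
move=> gc /andP[_]; rewrite inE/= /finite_norm => gfin.
have l_ge0 := Lnorm_ge0 (@leb2 R) +oo%E (EFin \o g).
exists (fine ('N[@leb2 R]_(+oo) [EFin \o g])%E).
  by rewrite fine_ge0// fineK// ge0_fin_numE.
(* The norm of exponent +oo is the essential supremum only if the measure is
   not null; otherwise it is 0 by convention. *)
have T_gt0 : (0 < @leb2 R setT)%E.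
  by apply: (@leb2_nbhs_gt0 _ (0, 0) setT) => //; exact: filterT.
apply: ae_le_continuous.
  by move=> z; apply: continuous_comp; [exact: gc|exact: norm_continuous].
have := ess_sup_ge (@leb2 R) (abse \o (EFin \o g)).
move: gfin l_ge0; rewrite unlock T_gt0 => gfin l_ge0.
apply: filterS => w /=.
by rewrite -lee_fin fineK// ge0_fin_numE.
Qed.

(** The mean value theorem applied to r |-> f (r, A) between 0 and r. *)
Lemma le_d_rho_bound (R : realType) (f : R * R -> R) (l : R) :
  (forall z, derivable f z (1, 0)) ->
  (forall A, f (0, A) = 0) -> (forall z, `|d_rho f z| <= l) ->
  forall r A, `|f (r, A)| <= l * `|r|.
Proof.
move=> fd f0 fl r A.
pose g := fun x => f (x, A).
have gd (x : R) : is_derive x (1 : R) g (d_rho f (x, A)).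
  (* The difference quotient of g is that of f along (1, 0). *)
  have E : (fun h : R => h^-1 *: ((g \o shift x) (h *: 1) - g x)) =
           (fun h : R => h^-1 *: ((f \o shift (x, A)) (h *: (1, 0)) - f (x, A))).
    apply/funext => h; rewrite /g/=; congr (_ *: (f _ - _)).
    by congr (_, _); rewrite /= scaler0 add0r.
  split; first by have := fd (x, A); rewrite /derivable E.
  by rewrite /d_rho /derive E.
have gc : continuous g.
  move=> x; have [gx _] := gd x.
  exact/differentiable_continuous/derivable1_diffP.
have gw a b : {within `[a, b], continuous g} by exact: continuous_subspaceT.
have [r0|r0] := leP 0 r.
- have [c _] := MVT_segment r0 (fun x _ => gd x) (gw _ _).
  by rewrite /g f0 !subr0 => ->; rewrite normrM ler_wpM2r.
- have [c _] := MVT_segment (ltW r0) (fun x _ => gd x) (gw _ _).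
  rewrite /g f0 !sub0r mulrN => /oppr_inj ->.
  by rewrite normrM ler_wpM2r.
Qed.

(** A positive slope is bounded by its backward difference
rho_j - rho_(j-1) <= rho_j, a negative one by the opposite of its forward
difference rho_j - rho_(j+1) <= rho_j. *)
Lemma slope_le (R : realType) (theta : R) (rho : int -> R) (j : int) :
  0 <= theta <= 2^-1 -> (forall i, 0 <= rho i) ->
  `|slope theta rho j| <= rho j.
Proof.
move=> /andP[t0 t1] r0; rewrite /slope.
have rj := r0 j.
set m := minmod _ _ _.
suff mr : `|m| <= rho j.
  rewrite normrM ger0_norm; last by lra.
  apply: le_trans mr; rewrite -[leRHS]mul1r ler_wpM2r//; lra.
rewrite /m /minmod; case: ifPn => [/and3P[a b c]|_].
  rewrite ger0_norm; last by rewrite !le_min !ltW.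
  by rewrite ge_min; apply/orP; left; rewrite lerBlDr lerDl.
case: ifPn => [/and3P[a b c]|_]; last by rewrite normr0.
rewrite ler0_norm; last by rewrite !ge_max !ltW.
rewrite lerNl !le_max; apply/orP; right; apply/orP; right.
by rewrite -lerBlDr opprK addNr.
Qed.

Section positivity.
Context {R : realType}.
Variables (f : R * R -> R) (mu : R -> R) (theta alpha dx dt l : R).
Hypotheses (theta_bounds : 0 <= theta <= 2^-1) (dx0 : 0 < dx) (dt0 : 0 < dt)
  (fl : forall r A, `|f (r, A)| <= l * `|r|).

(** Both face values are nonnegative and their sum is 2 rho_j, so the linear
bound on f applied to each of them gives the estimate. *)
Lemma delta_le rho j : (forall i, 0 <= rho i) ->
  `|delta f mu theta dx rho j| <= 2 * l * rho j.
Proof.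
move=> r0; have := slope_le j theta_bounds r0.
rewrite ler_norml => /andP[s1 s2]; have rj := r0 j.
rewrite /delta (le_trans (ler_normB _ _))//.
have fm := fl (face_minus theta rho j) (conv_minus mu theta dx rho j).
have fp := fl (face_plus theta rho j) (conv_plus mu theta dx rho j).
rewrite (le_trans (lerD fm fp))// -mulrDr !ger0_norm /face_minus /face_plus.
- by rewrite [leLHS](_ : _ = 2 * l * rho j)//; field.
- by lra.
- by lra.
Qed.

Hypothesis cfl2 : lambda dx dt * l <= 2 / 27.

Lemma lambda_delta_le rho j : (forall i, 0 <= rho i) ->
  `|lambda dx dt * delta f mu theta dx rho j| <= 4 / 27 * rho j.
Proof.
move=> r0; have la0 : 0 < lambda dx dt by rewrite divr_gt0.
rewrite normrM gtr0_norm//.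
apply: (@le_trans _ _ (lambda dx dt * (2 * l * rho j))).
  by rewrite ler_pM2l// delta_le.
have -> : lambda dx dt * (2 * l * rho j) = lambda dx dt * l * (2 * rho j).
  by ring.
have -> : 4 / 27 * rho j = 2 / 27 * (2 * rho j) by field.
by rewrite ler_wpM2r// mulr_ge0.
Qed.

(** A face value is at least rho_j / 2, and its half-step correction at most
2/27 rho_j. *)
Lemma mid_ge0 rho j : (forall i, 0 <= rho i) ->
  0 <= mid_minus f mu theta dx dt rho j /\ 0 <= mid_plus f mu theta dx dt rho j.
Proof.
move=> r0; have := slope_le j theta_bounds r0.
have := lambda_delta_le j r0; rewrite !ler_norml => /andP[d1 d2] /andP[s1 s2].
have rj := r0 j; rewrite /mid_minus /mid_plus /face_minus /face_plus.
by split; lra.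
Qed.

Hypotheses (cfl3 : lambda dx dt * l <= alpha)
  (cfl1 : lambda dx dt * l <= (8 - 27 * alpha) / 27).

(** The neighbours contribute nonnegatively by [cfl3]; the contribution of the
cell itself is at least (1 - 4/27 * (2 + 4/27)) rho_j by [cfl1] and
[lambda_delta_le]. *)
Lemma update_ge0 rho : (forall i, 0 <= rho i) ->
  forall j, 0 <= update f mu theta alpha dx dt rho j.
Proof.
move=> r0 j.
have la0 : 0 < lambda dx dt by rewrite divr_gt0.
have [m0 p0] := mid_ge0 j r0.
have [m1 _] := mid_ge0 (j - 1) r0.
have [_ p2] := mid_ge0 (j + 1) r0.
have := lambda_delta_le j r0; rewrite ler_norml => /andP[d1 d2].
have rj := r0 j.
have mp : mid_minus f mu theta dx dt rho j + mid_plus f mu theta dx dt rho j =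
  2 * rho j - lambda dx dt * delta f mu theta dx rho j.
  by rewrite /mid_minus /mid_plus /face_minus /face_plus; field.
have lf r A : 0 <= r -> `|lambda dx dt * f (r, A)| <= lambda dx dt * l * r.
  move=> rr; rewrite normrM gtr0_norm// -mulrA ler_pM2l//.
  by rewrite (le_trans (fl _ _))// ger0_norm.
have [c1 c3] := (cfl1, cfl3).
rewrite /update /mid_flux /num_flux subrK.
set a := mid_conv _ _ _ _ _ _ j; set b := mid_conv _ _ _ _ _ _ (j - 1).
set m := mid_minus _ _ _ _ _ _ j in mp m0 *;
  set p := mid_plus _ _ _ _ _ _ j in mp p0 *.
set m' := mid_minus _ _ _ _ _ _ (j - 1) in m1 *;
  set p' := mid_plus _ _ _ _ _ _ (j + 1) in p2 *.
set d := delta _ _ _ _ _ _ in d1 d2 mp *.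
set la := lambda _ _ in la0 lf c1 c3 d1 d2 mp *.
have := lf m a m0; have := lf p' a p2; have := lf m' b m1; have := lf p b p0.
rewrite !ler_norml => /andP[h1 h2] /andP[h3 h4] /andP[h5 h6] /andP[h7 h8].
(* The flux and the viscosity are separated, clearing the division by la. *)
have -> : rho j - la *
  ((f (m, a) + f (p', a)) / 2 - alpha / (2 * la) * (p' - m) -
   ((f (m', b) + f (p, b)) / 2 - alpha / (2 * la) * (p - m'))) =
  rho j - (la * f (m, a) + la * f (p', a) - la * f (m', b) - la * f (p, b)) / 2
  + alpha / 2 * (p' + m' - m - p).
  by field; rewrite gt_eqF.
have p'_visc : la * l * p' <= alpha * p' by rewrite ler_wpM2r.
have m'_visc : la * l * m' <= alpha * m' by rewrite ler_wpM2r.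
have mp_loss : (la * l + alpha) * (m + p) <= 8 / 27 * (m + p).
  by rewrite ler_wpM2r ?(addr_ge0 m0 p0)//; lra.
(* Only the inequalities above matter from now on, and they are linear in the
   products that occur in them. *)
clearbody la m p m' p' d; lra.
Qed.

Lemma scheme_ge0 rho0 n : (forall i, 0 <= cell_average dx rho0 i) ->
  forall j, 0 <= scheme f mu theta alpha dx dt rho0 n j.
Proof. by move=> r0; elim: n => [//|n IHn] j; exact: update_ge0. Qed.

End positivity.

(** The integrand equals its absolute value almost everywhere, so the integral
is that of a function that is nonnegative at every point. *)
Lemma ae_Rintegral_ge0 (d : measure_display) (T : measurableType d)
    (R : realType) (m : {measure set T -> \bar R}) (D : set T) (g : T -> R) :
  measurable D -> measurable_fun D g -> {ae m, forall x, 0 <= g x} ->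
  0 <= \int[m]_(x in D) g x.
Proof.
move=> mD mg g0; rewrite fine_ge0//.
have -> : (\int[m]_(x in D) (g x)%:E = \int[m]_(x in D) `|g x|%:E)%E.
  apply: ae_eq_integral => //; [exact/measurable_EFinP| |].
    by apply/measurable_EFinP; exact: measurableT_comp.
  by apply: filterS g0 => x gx0 _ /=; rewrite ger0_norm.
by apply: integral_ge0 => x _; rewrite lee_fin.
Qed.

Lemma cell_average_ge0 (R : realType) (dx : R) (rho0 : R -> R) :
  0 < dx -> rho0 \in Lfun (@lebesgue_measure R) +oo%E ->
  {ae @lebesgue_measure R, forall x, 0 <= rho0 x} ->
  forall j, 0 <= cell_average dx rho0 j.
Proof.
move=> dx0 /andP[+ _] r0 j; rewrite inE/= => mr.
rewrite /cell_average mulr_ge0 ?invr_ge0 ?(ltW dx0)//.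
apply: ae_Rintegral_ge0 r0; first exact: measurable_itv.
exact: measurable_funTS.
Qed.

(** For l = 0 and c > 0 the quotient is +oo and the last hypothesis is void,
but the conclusion then reads 0 <= c; this is why c must be nonnegative. *)
Lemma ereal_le_div (R : realType) (h c l : R) : 0 <= l -> 0 <= c ->
  (h%:E <= c%:E / l%:E)%E -> h * l <= c.
Proof.
rewrite le_eqVlt => /predU1P[<- c0 _|l0 _]; first by rewrite mulr0.
by rewrite inver gt_eqF// lee_fin ler_pdivlMr.
Qed.

Theorem theorem4p1 (R : realType) (f : R * R -> R) (mu : R -> R)
    (M theta alpha dx dt : R) (rho0 : R -> R)
    (f_C2 : Ck2 2 f)
    (f_rho_bounded : d_rho f \in Lfun leb2 +oo%E)
    (f_0 : forall A : R, f (0, A) = 0)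
    (M_gt0 : 0 < M)
    (f_A_bound : forall r A : R, `|d_A f (r, A)| <= M * `|r|)
    (f_AA_bound : forall r A : R, `|d_A (d_A f) (r, A)| <= M * `|r|)
    (f_rho_W1 : Wkinfty2 1 (d_rho f))
    (mu_C2 : Ck1 2 mu)
    (mu_supp : compactly_supported mu)
    (mu_W2 : Wkinfty1 2 mu)
    (theta_bounds : 0 <= theta <= 2^-1)
    (alpha_bounds : 0 < alpha < 8 / 27)
    (dx_gt0 : 0 < dx)
    (dt_gt0 : 0 < dt)
    (rho0_bounded : rho0 \in Lfun (@lebesgue_measure R) +oo%E)
    (rho0_ge0 : {ae @lebesgue_measure R, forall x, 0 <= rho0 x})
    (* the extended real inverse of 0 is +oo *)
    (CFL : let L := ('N[leb2]_(+oo) [EFin \o d_rho f])%E in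
      ((dt / dx)%:E <= mine (mine ((8 - 27 * alpha)%:E / (27%:E * L))
                                  (2%:E / (27%:E * L)))
                            (alpha%:E / L))%E) :
  {ae @leb2 R, forall z : R * R,
     0 <= z.1 -> 0 <= approx_solution f mu theta alpha dx dt rho0 z.1 z.2}.
Proof.
(* The cell values are all nonnegative, so the inequality holds everywhere. *)
apply: aeW => z _.
have [_ fD] := f_C2; have [fd [frc _]] := fD true.
have [l [l0 El] fl] := continuous_le_Lnormy frc f_rho_bounded.
have {}fl := le_d_rho_bound fd f_0 fl.
case/andP: alpha_bounds => a0 a1.
move: CFL => /=; rewrite El -EFinM !le_min => /andP[/andP[]].
have l27 : 0 <= 27 * l by rewrite mulr_ge0.
move=> /(ereal_le_div l27) c1 /(ereal_le_div l27) c2 /(ereal_le_div l0) c3.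
apply: (@scheme_ge0 _ _ _ _ _ _ _ l) => //.
- by have := c2 (ler0n _ _); rewrite /lambda; lra.
- by exact/c3/ltW.
- by have : 0 <= 8 - 27 * alpha by [lra]; move=> /c1; rewrite /lambda; lra.
- exact: cell_average_ge0.
Qed.
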